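(* There exists a directed set $\mathcal A$, which is not a cardinal number, with $\operatorname{card}(\mathcal A)=\operatorname{cov}(\mathcal N)$, such that $\mathcal{ANM}_{\mathcal A}\setminus\mathcal{ND}_{\mathcal A}$ is $2^{\mathfrak c}$-coneable in $\left(\mathbb R^{[0,1]}\right)^{\mathcal A}$.
   Context: A directed set is a nonempty set $\mathcal A$ with a reflexive transitive relation $\le$ in which any two elements have an upper bound; net convergence: $x_A\to x$ if for each neighbourhood $U$ of $x$ there is $A_0$ with $x_A\in U$ for all $A\ge A_0$. $\left(\mathbb R^{[0,1]}\right)^{\mathcal A}$ is the real vector space (algebra) of nets of functions $[0,1]\to\mathbb R$ with indexwise operations. $\lambda$ is Lebesgue measure, $\mathcal N$ the Lebesgue null subsets of $[0,1]$, $\operatorname{cov}(\mathcal N)$ the least size of a subfamily of $\mathcal N$ covering $[0,1]$. $\mathcal{ANM}_{\mathcal A}$: nets of Lebesgue measurable $f_A:[0,1]\to\mathbb R$ converging a.e. to a measurable $f$ but not converging in measure to $f$ (i.e. there is $\varepsilon>0$ such that $\lambda(\{x:|f_A(x)-f(x)|\ge\varepsilon\})$ does not converge to $0$). $\mathcal{ND}_{\mathcal A}$: nets of Lebesgue measurable $f_A:[0,1]\to\mathbb R$ such that there is an integrable $g$ with $|f_A|\le g$ a.e. for all $A$, $f_A\to f$ a.e. for some integrable $f$, and $\int|f_A-f|\,d\lambda$ does not converge to $0$. A set $S$ is positively (resp. negatively) $\kappa$-coneable if there is a linearly independent $B\subset S$, $\operatorname{card}(B)=\kappa$, such that all finite combinations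 $\sum a_ix_i$, $x_i\in B$, with all $a_i>0$ (resp. all $a_i<0$) lie in $S$; $S$ is $\kappa$-coneable if it is both positively and negatively $\kappa$-coneable. *)

(* Defs.v *)
From mathcomp Require Import all_boot all_order all_algebra.
From mathcomp Require Import all_classical all_reals all_analysis.
Set Implicit Arguments. Unset Strict Implicit. Unset Printing Implicit Defensive.
Import Order.TTheory GRing.Theory Num.Theory.
Import numFieldNormedType.Exports.
Local Open Scope classical_set_scope.
Local Open Scope ring_scope.
Local Open Scope card_scope.

Definition directed_set (A : Type) (le : A -> A -> Prop) : Prop :=
  [/\ inhabited A,
      (forall a, le a a),
      (forall a b c, le a b -> le b c -> le a c) &
      (forall a b, exists c, le a c /\ le b c)].

(** (A, le) is (order-isomorphic to) a cardinal number with its natural order,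
    i.e. an initial ordinal: a well-order every proper initial segment of which
    has strictly smaller cardinality than A. *)
Definition is_cardinal_order (A : Type) (le : A -> A -> Prop) : Prop :=
  [/\ (forall a b, le a b -> le b a -> a = b),
      (forall a b, le a b \/ le b a),
      (forall S : set A, S !=set0 -> exists2 m, S m & forall s, S s -> le m s) &
      (forall a : A, ~ ([set: A] #<= [set b | le b a /\ b <> a]))].

Definition net_cvg {A : Type} (le : A -> A -> Prop) {T : topologicalType}
  (u : A -> T) (l : T) : Prop :=
  forall U, nbhs l U -> exists a0, forall a, le a0 a -> U (u a).

(** The Lebesgue (completed) measure space on R. *)
Definition LR (R : realType) :=
  caratheodory_type (R := R) (wlength (R := R) idfun)^*%mu.

Definition Leb {R : realType} : set (LR R) -> \bar R :=
  @completed_lebesgue_measure R.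

Definition D01 {R : realType} : set (LR R) := [set x | 0 <= (x : R) <= 1].

Definition I01 (R : realType) := {x : R | 0 <= x <= 1}.

(** A function [0,1] -> R, extended by 0 to R (only used to speak of
    measurability/integrals on [0,1]). *)
Definition ext01 {R : realType} (f : I01 R -> R) : LR R -> R :=
  fun x => oapp f 0 (insub (x : R)).

Definition net (A : Type) (R : realType) := A -> I01 R -> R.

Definition lmeas {R : realType} (f : I01 R -> R) : Prop :=
  measurable_fun D01 (ext01 f).

Definition lintegrable {R : realType} (f : I01 R -> R) : Prop :=
  Leb.-integrable D01 (EFin \o ext01 f).

Definition net_cvg_ae {A : Type} (le : A -> A -> Prop) {R : realType}
  (F : net A R) (f : I01 R -> R) : Prop :=
  {ae Leb, forall x : LR R, D01 x ->
     net_cvg le (fun a => ext01 (F a) x) (ext01 f x)}.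

Definition net_cvg_meas {A : Type} (le : A -> A -> Prop) {R : realType}
  (F : net A R) (f : I01 R -> R) : Prop :=
  forall eps : R, 0 < eps ->
    net_cvg le (fun a => Leb (D01 `&` [set x | eps <= `|ext01 (F a) x - ext01 f x|]))
      0%E.

Definition ANM {A : Type} (le : A -> A -> Prop) {R : realType} : set (net A R) :=
  [set F | (forall a, lmeas (F a)) /\
     exists f, [/\ lmeas f, net_cvg_ae le F f & ~ net_cvg_meas le F f]].

Definition ND {A : Type} (le : A -> A -> Prop) {R : realType} : set (net A R) :=
  [set F | (forall a, lmeas (F a)) /\
     exists g, [/\ lintegrable g,
       (forall a, {ae Leb, forall x : LR R, D01 x -> `|ext01 (F a) x| <= ext01 g x}) &
       exists f, [/\ lintegrable f, net_cvg_ae le F f &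
         ~ net_cvg le
             (fun a => (\int[Leb]_(x in D01) (`|ext01 (F a) x - ext01 f x|)%:E)%E)
             0%E]]].

Definition comb {A : Type} {R : realType} (n : nat) (c : 'I_n -> R)
  (x : 'I_n -> net A R) : net A R :=
  fun a t => \sum_(i < n) c i * x i a t.

Definition lin_indep {A : Type} {R : realType} (B : set (net A R)) : Prop :=
  forall (n : nat) (c : 'I_n -> R) (x : 'I_n -> net A R),
    injective x -> (forall i, B (x i)) ->
    (forall a t, comb c x a t = 0) -> forall i, c i = 0.

Definition pos_coneable {A : Type} {R : realType} {U : Type}
  (S : set (net A R)) (K : set U) : Prop :=
  exists B : set (net A R), [/\ lin_indep B, B #= K &
    forall (n : nat) (c : 'I_n.+1 -> R) (x : 'I_n.+1 -> net A R),
      (forall i, B (x i)) -> (forall i, 0 < c i) -> S (comb c x)].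

Definition neg_coneable {A : Type} {R : realType} {U : Type}
  (S : set (net A R)) (K : set U) : Prop :=
  exists B : set (net A R), [/\ lin_indep B, B #= K &
    forall (n : nat) (c : 'I_n.+1 -> R) (x : 'I_n.+1 -> net A R),
      (forall i, B (x i)) -> (forall i, c i < 0) -> S (comb c x)].

Definition coneable {A : Type} {R : realType} {U : Type}
  (S : set (net A R)) (K : set U) : Prop :=
  pos_coneable S K /\ neg_coneable S K.

Definition card_is_covN (R : realType) (A : Type) : Prop :=
  (exists F : A -> set (LR R),
     (forall a, F a `<=` D01 /\ Leb.-negligible (F a)) /\
     D01 `<=` \bigcup_a F a) /\
  (forall Fam : set (set (LR R)),
     (forall N, Fam N -> N `<=` D01 /\ Leb.-negligible N) ->
     D01 `<=` \bigcup_(N in Fam) N ->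
     [set: A] #<= Fam).

(* Main.v *)
Require Import Defs.
From mathcomp Require Import all_boot all_order all_algebra.
From mathcomp Require Import all_classical all_reals all_analysis.
From mathcomp Require Import ring lra.
Import Order.TTheory GRing.Theory Num.Theory.
Import numFieldNormedType.Exports.
Local Open Scope classical_set_scope.
Local Open Scope ring_scope.
Local Open Scope card_scope.

(** Let [K] be a cover of [0,1] by null sets of least cardinality.  It is
    infinite, so the lists over [K], preordered by inclusion of the unions of
    their members, form a directed set of cardinality |K| = cov(N); this preorder
    is not antisymmetric, hence not a cardinal.  The net sending a list [l] to
    [size l + 1] off the union of [l] and to [0] on it converges to [0]
    everywhere, because each point is eventually covered; every term is at least
    [1] almost everywhere, so there is no convergence in measure; and since the
    essential infima [size l + 1] are unbounded, no real-valued function dominates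
    the net, which excludes [ND].  Adding a function supported on a fixed null set
    affects none of this, and a null set of the cardinality of the continuum
    carries 2^c linearly independent functions.  Index its points by finite lists
    of pairs (real, boolean); to a set [s] of reals corresponds the indicator of
    the lists whose booleans all tell correctly whether the real belongs to [s].
    Finitely many distinct sets are separated by such lists.  A linear combination
    of the resulting nets lies in ANM \ ND as soon as the sum of its coefficients
    is nonzero, which covers both positive and negative combinations. *)

(** * Comparison of cardinalities by injections and Zorn's lemma *)

Lemma card_le_inj (T U : Type) (A : set T) (B : set U) (f : T -> U) :
  (forall x, A x -> B (f x)) ->
  (forall x y, A x -> A y -> f x = f y -> x = y) -> A #<= B.
Proof.
move=> fAB finj.
have [g] : $|{injfun A >-> B}|.
  apply/injfunPex; exists f => // x y; rewrite !inE; exact: finj.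
exact: inj_card_le g.
Qed.

Lemma card_le_injP (T : Type) (U : pointedType) (A : set T) (B : set U) :
  A #<= B -> exists f : T -> U, (forall x, A x -> B (f x)) /\
  (forall x y, A x -> A y -> f x = f y -> x = y).
Proof.
move=> /pcard_leP/injfunPex[f fAB finj]; exists f; split => // x y Ax Ay.
by apply: finj; rewrite inE.
Qed.

(* Honig: in a maximal set Z of choice functions on which every evaluation is
   injective, some evaluation is onto, otherwise Z could be enlarged. *)
Lemma exists_least_card (I T : Type) (X : I -> set T) (i0 : I) :
  exists i, forall j, X i #<= X j.
Proof.
have [[i Xi0]|Xn0] := pselect (exists i, X i = set0).
  by exists i => j; rewrite Xi0.
have Xne i : exists x, X i x.
  by apply/set0P/eqP => Xi; apply: Xn0; exists i.
pose P (Z : set (I -> T)) := (forall f, Z f -> forall i, X i (f i)) /\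
  (forall f g i, Z f -> Z g -> f i = g i -> f = g).
have [|Z [[ZX Zinj] Zmax]] := @Zorn_bigcup _ P.
  move=> F FP Ftot; split => [f [Z FZ Zf]|f g i [Z FZ Zf] [Z' FZ' Z'g]].
    exact: (FP _ FZ).1.
  have [ZZ'|Z'Z] := Ftot _ _ FZ FZ'.
    exact: (FP _ FZ').2 (ZZ' _ Zf) Z'g.
  exact: (FP _ FZ).2 Zf (Z'Z _ Z'g).
have [[i Xi]|noi] := pselect (exists i, X i `<=` [set f i | f in Z]).
  exists i => j.
  apply: (@card_le_trans _ _ _ Z).
    exact: card_le_trans (subset_card_le Xi) (card_image_le _ _).
  apply: (@card_le_inj _ _ _ _ (fun f => f j)) => [f Zf|f g Zf Zg].
    exact: ZX.
  exact: Zinj.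
have /choice[y yP] : forall i, exists x, X i x /\ ~ [set f i | f in Z] x.
  move=> i; apply: contrapT => /forallNP nx; apply: noi; exists i => x Xx.
  by apply: contrapT => nZ; exact: (nx x).
exfalso; apply: (Zmax (Z `|` [set y])).
  split=> [|/(_ y (or_intror erefl)) Zy]; first exact: subsetUl.
  by apply: (yP i0).2; exists y.
split=> [f [/ZX//|-> i]|f g i [Zf|->] [Zg|->]] //.
- exact: (yP i).1.
- exact: Zinj.
- by move=> fy; case: (yP i).2; exists f.
- by move=> yg; case: (yP i).2; exists g.
Qed.

(** * Lists over an infinite set *)

Section SeqCard.
Variables (T : pointedType) (a b : T).

Let over (Y : set T) (l : seq T) := forall x, x \in l -> Y x.

(** The map is total, but only its values at lists over [p.1] are constrained: there it is an
    injection into [p.1]. *)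
Let good (p : set T * (seq T -> T)) :=
  [/\ p.1 a, p.1 b, (forall l, over p.1 l -> p.1 (p.2 l)) &
    forall l m, over p.1 l -> over p.1 m -> p.2 l = p.2 m -> l = m].

(* [a] and [b] serve as tags, so that lists over Y also encode the points
   outside Y which e sends injectively into Y. *)
Lemma seq_injection_extend (Y D : set T) (g : seq T -> T) (e : T -> T) :
  a <> b -> good (Y, g) ->
  (forall x, D x -> ~ Y x -> Y (e x)) ->
  (forall x y, D x -> D y -> ~ Y x -> ~ Y y -> e x = e y -> x = y) ->
  exists k : seq T -> T, (forall l, over D l -> Y (k l)) /\
    forall l m, over D l -> over D m -> k l = k m -> l = m.
Proof.
move=> ab [/= Ya Yb gY ginj] eY einj.
pose d x := if `[< Y x >] then g [:: x; a] else g [:: e x; b].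
have ov2 x y : Y x -> Y y -> over Y [:: x; y].
  by move=> Yx Yy z; rewrite !inE => /orP[] /eqP ->.
have dY x : D x -> Y (d x).
  by move=> Dx; rewrite /d; case: asboolP => Yx; apply: gY; apply: ov2 => //; exact: eY.
have dinj x y : D x -> D y -> d x = d y -> x = y.
  move=> Dx Dy; rewrite /d; case: asboolP => Yx; case: asboolP => Yy.
  - by move/(ginj _ _ (ov2 _ _ Yx Ya) (ov2 _ _ Yy Ya)) => -[].
  - by move/(ginj _ _ (ov2 _ _ Yx Ya) (ov2 _ _ (eY _ Dy Yy) Yb)) => -[].
  - move/(ginj _ _ (ov2 _ _ (eY _ Dx Yx) Yb) (ov2 _ _ Yy Ya)) => -[_ ba].
    by case: ab.
  - move/(ginj _ _ (ov2 _ _ (eY _ Dx Yx) Yb) (ov2 _ _ (eY _ Dy Yy) Yb)) => -[].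
    exact: einj.
have od l : over D l -> over Y (map d l).
  by move=> Dl _ /mapP[x xl ->]; apply/dY/Dl.
exists (fun l => g (map d l)); split=> [l /od/gY//|l m Dl Dm].
move/(ginj _ _ (od _ Dl) (od _ Dm)).
elim: l m Dl Dm => [|x l IH] [|y m] //= Dl Dm [] dxy lm.
have [Dx Dy] : D x /\ D y by split; [apply: Dl|apply: Dm]; rewrite inE eqxx.
rewrite (dinj _ _ Dx Dy dxy) (IH m)// => z zl; [apply: Dl|apply: Dm];
  by rewrite inE zl orbT.
Qed.

Let ext_le (p q : set T * (seq T -> T)) :=
  p.1 `<=` q.1 /\ forall l, over p.1 l -> q.2 l = p.2 l.

(** Zorn: a list has finitely many entries, so a list over the union of a nonempty chain lies over
    one member, whose map gives its value. *)
Lemma seq_injection_maximal (p0 : set T * (seq T -> T)) : good p0 ->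
  exists2 p, good p & forall q, good q -> ext_le p q -> q.1 `<=` p.1.
Proof.
move=> good0; pose G := {p | good p}.
pose t0 : G := exist _ p0 good0.
pose leG (p q : G) := `[< ext_le (sval p) (sval q) >].
have [|||p pmax] := @ZL_preorder G t0 leG.
- by move=> p; apply/asboolP; split.
- move=> q p r /asboolP[pq pqE] /asboolP[qr qrE]; apply/asboolP; split.
    exact: subset_trans pq qr.
  by move=> l pl; rewrite qrE ?pqE// => x /pl /pq.
- move=> C Ctot; have [[c Cc]|C0] := pselect (C !=set0); last first.
    by exists t0 => s Cs; case: C0; exists s.
  pose Y := [set x | exists2 p : G, C p & (sval p).1 x].
  pose at_ l := [set p : G | C p /\ over (sval p).1 l].
  have Yl l : over Y l -> exists p, at_ l p.
    elim: l => [|x l IH] Yxl; first by exists c; split.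
    have [p [Cp pl]] : exists p, at_ l p.
      by apply: IH => z zl; apply: Yxl; rewrite inE zl orbT.
    have [q Cq qx] : Y x by apply: Yxl; rewrite inE eqxx.
    have [/asboolP[pq _]|/asboolP[qp _]] := Ctot _ _ Cp Cq.
      exists q; split => // z; rewrite inE => /orP[/eqP ->//|/pl]; exact: pq.
    by exists p; split => // z; rewrite inE => /orP[/eqP ->|/pl//]; exact: qp.
  have /choice[w wP] : forall l, exists p, over Y l -> at_ l p.
    move=> l; have [/Yl[p ?]|nYl] := pselect (over Y l); first by exists p.
    by exists t0 => /nYl.
  pose g l := (sval (w l)).2 l.
  have gE p l : C p -> over (sval p).1 l -> g l = (sval p).2 l.
    move=> Cp pl; have /wP[Cq ql] : over Y l by move=> x /pl; exists p.
    have [/asboolP[_ pq]|/asboolP[_ qp]] := Ctot _ _ Cp Cq.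
      exact: pq.
    by rewrite /g -qp.
  have goodY : good (Y, g).
    split => /=.
    - by exists c => //; case: (svalP c).
    - by exists c => //; case: (svalP c).
    - move=> l /Yl[p [Cp pl]]; exists p => //; rewrite (gE p)//.
      by case: (svalP p) => _ _ + _; apply.
    - move=> l m Y1 Y2.
      (* Passing to [l ++ m] puts both lists over the same member of the chain. *)
      have [p [Cp plm]] : exists p, at_ (l ++ m) p.
        by apply: Yl => x; rewrite mem_cat => /orP[/Y1|/Y2].
      have pl : over (sval p).1 l by move=> x xl; apply: plm; rewrite mem_cat xl.
      have pm : over (sval p).1 m.
        by move=> x xm; apply: plm; rewrite mem_cat xm orbT.
      by rewrite !(gE p)//; case: (svalP p) => _ _ _; apply.
  exists (exist _ _ goodY) => p Cp; apply/asboolP; split=> [x px|l pl] /=.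
    by exists p.
  exact: gE.
exists (sval p); first exact: svalP.
move=> q gq pq; have /asboolP[] : leG (exist _ q gq) p; last by [].
by apply: pmax; apply/asboolP.
Qed.

End SeqCard.

Lemma card_seq_le (T : Type) : infinite_set [set: T] -> [set: seq T] #<= [set: T].
Proof.
elim/Ppointed: T => T; first by rewrite emptyE => /(_ (finite_set0 _)).
move=> /infiniteP /card_le_injP[f [_ finj]].
have {}finj i j : f i = f j -> i = j by exact: finj.
pose finv x := xget 0%N [set i | f i = x].
have fK i : finv (f i) = i.
  by rewrite /finv; case: xgetP => [j _ /finj//|/(_ i)/(_ erefl)].
pose over (Y : set T) (l : seq T) := forall x, x \in l -> Y x.
have ab : f 0%N <> f 1%N by move/finj.
(* The starting pair is a countable set, whose lists are coded as lists of naturals. *)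
have [|[Y g] [/= Ya Yb gY ginj] pmax] :=
    @seq_injection_maximal T (f 0%N) (f 1%N)
      (range f, fun l => f (pickle (map finv l))).
  split => /=; [by exists 0%N | by exists 1%N | by move=> l _; eexists |].
  move=> l m fl fm /finj /(pcan_inj pickleK) /(congr1 (map f)).
  rewrite -!map_comp !map_id_in// => x; [move/fm|move/fl] => -[i _ <-] /=;
    by rewrite fK.
have goodY : [/\ Y (f 0%N), Y (f 1%N), (forall l, over Y l -> Y (g l)) &
    forall l m, over Y l -> over Y m -> g l = g m -> l = m] by split.
pose X (i : bool) := if i then ~` Y else Y.
have [[] /(_ (~~ _)) /= h] := exists_least_card _ _ X true.
  have /card_le_injP[e [eY einj]] := h true.
  have [||k [_ kinj]] := seq_injection_extend _ _ _ _ setT g e ab goodY.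
  - by move=> x _; exact: eY.
  - by move=> x y _ _ /einj; exact.
  by apply: (card_le_inj _ _ _ _ k) => // l m _ _; exact: kinj.
have /card_le_injP[e [eY einj]] := h false.
exfalso.
pose e' x := xget (f 0%N) [set y | Y y /\ e y = x].
have e'K y : Y y -> e' (e y) = y.
  move=> Yy; rewrite /e'; case: xgetP => [z _ [Yz /einj]|/(_ y)[]//].
  exact.
pose D := Y `|` e @` Y.
have De x : D x -> ~ Y x -> exists2 y, Y y & e y = x.
  by case.
have [||k [kY kinj]] := seq_injection_extend _ _ _ Y D g e' ab goodY.
- by move=> x Dx /(De _ Dx)[y Yy <-]; rewrite e'K.
- move=> x y Dx Dy /(De _ Dx)[x' Yx' <-] /(De _ Dy)[y' Yy' <-].
  by rewrite !e'K// => ->.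
(* Lists with an entry outside [Y] go outside [Y], so their values cannot collide with those of
   [g]. *)
pose g' l := if `[< over Y l >] then g l else e (k l).
suff : D `<=` Y by move=> DY; apply: (eY (f 0%N) Ya); apply: DY; right; exists (f 0%N).
apply: (pmax (D, g')); last first.
  split => /= [|l Yl]; first exact: subsetUl.
  by rewrite /g'; case: asboolP.
split=> /=; [by left | by left | |].
- move=> l Dl; rewrite /g'; case: asboolP => Yl; first by left; exact: gY.
  by right; exists (k l) => //; exact: kY.
- move=> l m Dl Dm; rewrite /g'; case: asboolP => Yl; case: asboolP => Ym.
  + exact: ginj.
  + by move=> gk; case: (eY (k m) (kY _ Dm)); rewrite -gk; exact: gY.
  + by move=> gk; case: (eY (k l) (kY _ Dl)); rewrite gk; exact: gY.
  + by move/(einj _ _ (kY _ Dl) (kY _ Dm)); exact: kinj.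
Qed.

(** * Completed Lebesgue measure *)

Section Lebesgue.
Context {R : realType}.
Implicit Types A B N : set (LR R).

(** As a function on all sets [Leb] is this outer measure, so monotonicity and subadditivity hold
    without measurability. *)
Let outer : {outer_measure set (ocitv_type R) -> \bar R} :=
  ((wlength (R := R) idfun)^*)%mu.

Lemma Leb_itvcc (a b : R) : a <= b -> Leb ([set x | a <= (x : R) <= b] : set (LR R)) = (b - a)%:E.
Proof.
move=> ab.
have -> : [set x | a <= (x : R) <= b] = `[a, b]%classic :> set R.
  by apply/seteqP; split => x /=; rewrite in_itv.
rewrite (_ : Leb _ = lebesgue_measure (`[a, b]%classic : set R))//.
rewrite lebesgue_measure_itv /= lte_fin; case: ltP => // ba.
by have -> : a = b by [apply/eqP; rewrite eq_le ab ba]; rewrite subrr.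
Qed.

Lemma Leb_ge0 A : (0 <= Leb A)%E.
Proof. exact: (outer_measure_ge0 outer). Qed.

Lemma le_Leb A B : A `<=` B -> (Leb A <= Leb B)%E.
Proof. exact: (le_outer_measure outer). Qed.

Lemma LebU_le A B : (Leb (A `|` B) <= Leb A + Leb B)%E.
Proof. exact: (outer_measureU2 outer). Qed.

Lemma Leb0_negligible N : Leb N = 0%E -> Leb.-negligible N.
Proof.
move=> N0.
suff mN : caratheodory_measurable outer N by exists N; split.
apply: le_caratheodory_measurable => X.
have -> : outer (X `&` N) = 0%E.
  apply/eqP; rewrite eq_le Leb_ge0 andbT -N0.
  by apply: (le_outer_measure outer); exact: subIsetr.
by rewrite add0e; apply: (le_outer_measure outer); exact: subIsetl.
Qed.

Lemma negligible_Leb0 N : Leb.-negligible N -> Leb N = 0%E.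
Proof.
move=> [M [_ M0 NM]]; apply/eqP; rewrite eq_le Leb_ge0 andbT.
by rewrite -M0; exact: le_Leb.
Qed.

Lemma measurable_negligible N : Leb.-negligible N -> measurable N.
Proof. exact: completed_lebesgue_measure_is_complete. Qed.

Lemma measurable_D01 : measurable (D01 : set (LR R)).
Proof.
have -> : D01 = `[0, 1]%classic :> set R.
  by apply/seteqP; split => x /=; rewrite in_itv.
by apply: sub_caratheodory; exact: measurable_itv.
Qed.

Lemma Leb_D01 : Leb (D01 : set (LR R)) = 1%E.
Proof. by rewrite Leb_itvcc ?subr0// ler01. Qed.

Lemma not_negligible_D01 : ~ Leb.-negligible (D01 : set (LR R)).
Proof. by move/negligible_Leb0; rewrite Leb_D01 => -[] /eqP; rewrite oner_eq0. Qed.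

(** Up to a subset of [N], measurable by completeness, each preimage is all of [D01] or empty. *)
Lemma measurable_fun_ae_cst (h : LR R -> R) N (c : R) : Leb.-negligible N ->
  (forall x, D01 x -> ~ N x -> h x = c) -> measurable_fun D01 h.
Proof.
move=> N0 hc _ Y mY; set E := D01 `&` _.
have mEN : measurable (E `&` N).
  apply: measurable_negligible; apply: negligibleS N0; exact: subIsetr.
have [Yc|nYc] := pselect (Y c).
  have -> : E = (E `&` N) `|` (D01 `\` N).
    apply/seteqP; split=> [x Ex|x [[]//|[Dx Nx]]]; last by split => //=; rewrite hc.
    have [Nx|Nx] := pselect (N x); [by left | by right; case: Ex].
  apply: measurableU => //; apply: measurableD; first exact: measurable_D01.
  exact: measurable_negligible.
suff -> : E = E `&` N by [].
apply/seteqP; split=> [x Ex|x []//]; split => //.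
apply: contrapT => Nx; case: Ex => Dx /=; rewrite hc//.
Qed.
End Lebesgue.

(** * A null set of the cardinality of the continuum *)

Section CantorSet.
Context {R : realType}.

(** Partial sums of the base 4 expansion with digits 0 and 2. *)
Fixpoint quaternary_sum (n : nat) (b : nat -> bool) : R :=
  if n is m.+1 then (b 0%N)%:R / 2 + quaternary_sum m (b \o S) / 4 else 0.

Lemma quaternary_sum_itv n b : 0 <= quaternary_sum n b <= 1.
Proof.
elim: n b => [|n IH] b /=; first by rewrite lexx ler01.
have /andP[] := IH (b \o S); case: (b 0%N) => /=; lra.
Qed.

Lemma quaternary_sum_nd n b : quaternary_sum n b <= quaternary_sum n.+1 b.
Proof.
elim: n b => [|n IH] b; first by case/andP: (quaternary_sum_itv 1 b).
have := IH (b \o S); rewrite /=; lra.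
Qed.

Definition quaternary (b : nat -> bool) : R := limn (quaternary_sum^~ b).

Lemma quaternary_sum_cvg b : (quaternary_sum^~ b) n @[n --> \oo] --> quaternary b.
Proof.
apply: nondecreasing_is_cvgn.
  by apply/nondecreasing_seqP => n; exact: quaternary_sum_nd.
by exists 1 => _ [n _ <-]; case/andP: (quaternary_sum_itv n b).
Qed.

Lemma quaternary_itv b : 0 <= quaternary b <= 1.
Proof.
apply/andP; split.
  apply: limr_ge; first exact: quaternary_sum_cvg.
  by near=> n; case/andP: (quaternary_sum_itv n b).
apply: limr_le; first exact: quaternary_sum_cvg.
by near=> n; case/andP: (quaternary_sum_itv n b).
Unshelve. all: by end_near. Qed.

Lemma quaternaryS b : quaternary b = (b 0%N)%:R / 2 + quaternary (b \o S) / 4.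
Proof.
have cvg1 : (quaternary_sum n.+1 b) @[n --> \oo] -->
    (b 0%N)%:R / 2 + quaternary (b \o S) / 4.
  apply: cvgD; first exact: cvg_cst.
  by apply: cvgM; [exact: quaternary_sum_cvg|exact: cvg_cst].
have := quaternary_sum_cvg b; rewrite -cvg_shiftS => cvg2.
exact: (cvg_unique _ cvg2 cvg1).
Qed.

(** The first digit contributes 0 or 1/2 and the tail at most 1/4, so the first digit can be read
    off; then shift. *)
Lemma quaternary_inj : injective quaternary.
Proof.
move=> b b' bb'; apply/funext => n; elim: n b b' bb' => [|n IH] b b' bb'.
all: have := bb'; rewrite quaternaryS [in RHS]quaternaryS.
all: have := quaternary_itv (b \o S); have := quaternary_itv (b' \o S).
all: move=> /andP[? ?] /andP[? ?].
  by case: (b 0%N) (b' 0%N) => -[] //=; lra.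
move=> E; apply: (IH (b \o S) (b' \o S)).
by move: E; case: (b 0%N) (b' 0%N) => -[] //=; lra.
Qed.

(* [copy a r] is the union of [copy a (r / 4)] and [copy (a + r / 2) (r / 4)]:
   each subdivision halves the upper bound on its measure. *)
Let copy (a r : R) : set (LR R) := [set a + r * quaternary b | b in setT].

Lemma Leb_quaternary_le n (a r : R) : 0 <= r ->
  (Leb (copy a r) <= (r / 2 ^+ n)%:E)%E.
Proof.
elim: n a r => [|n IH] a r r0.
  have ar : a <= a + r by rewrite lerDl.
  rewrite expr0 divr1.
  apply: (@le_trans _ _ (Leb ([set x | a <= (x : R) <= a + r] : set (LR R)))).
    apply: le_Leb => _ [b _ <-] /=; have /andP[b0 b1] := quaternary_itv b.
    by rewrite lerDl mulr_ge0//= lerD2l ler_piMr.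
  by rewrite Leb_itvcc// addrAC subrr add0r.
have r4 : 0 <= r / 4 by rewrite divr_ge0.
apply: (@le_trans _ _ (Leb (copy a (r / 4) `|` copy (a + r / 2) (r / 4)))).
  apply: le_Leb => _ [b _ <-]; rewrite quaternaryS.
  case: (b 0%N); [right|left]; exists (b \o S) => //=; ring.
apply: le_trans (LebU_le _ _) _.
apply: le_trans (leeD (IH a _ r4) (IH (a + r / 2) _ r4)) _.
rewrite -EFinD lee_fin exprS invfM.
have : 0 <= (2 ^+ n)^-1 :> R by rewrite invr_ge0 exprn_ge0.
set t := _^-1; nra.
Qed.

Lemma negligible_quaternary : Leb.-negligible (range quaternary : set (LR R)).
Proof.
apply: Leb0_negligible; apply/eqP; rewrite eq_le Leb_ge0 andbT.
have le2 n : (Leb (range quaternary : set (LR R)) <= ((2 ^+ n)^-1)%:E)%E.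
  have := Leb_quaternary_le n 0 1 ler01; rewrite div1r.
  rewrite (_ : copy 0 1 = range quaternary)//.
  by apply: eq_imagel => b _; rewrite add0r mul1r.
apply/lee_addgt0Pr => e e0; rewrite add0e.
near \oo => n; apply: le_trans (le2 n) _; rewrite lee_fin.
rewrite -div1r ltW//; near: n.
exact: near_infty_natSinv_expn_lt (PosNum e0).
Unshelve. all: by end_near. Qed.
End CantorSet.

(** * Linearly independent functions on the null set *)

Section Code.
Context {R : realType}.

(* The list [l] is recorded by its size, its boolean entries and the Dedekind
   cuts of its real entries, so that [list_code l] is a point of Cantor space. *)
Definition list_code (l : seq (R * bool)) (n : nat) : bool :=
  let v i := nth (0, false) l i in
  if unpickle n is Some (i, q, t) then
    match t with
    | 0%N => (i < size l)%N
    | 1%N => (v i).2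
    | _ => ratr q < (v i).1
    end
  else false.

Lemma list_code_inj : injective list_code.
Proof.
move=> l m lm.
have E (i : nat) (q : rat) (t : nat) :
    list_code l (pickle (i, q, t)) = list_code m (pickle (i, q, t)).
  by rewrite lm.
have sz : size l = size m.
  apply/eqP; rewrite eqn_leq.
  have := E (size l) 0 0%N; have := E (size m) 0 0%N.
  rewrite /list_code !pickleK !ltnn => s1 s2.
  by rewrite leqNgt s1 leqNgt -s2.
apply: (@eq_from_nth _ (0, false)) => // i _.
have E1 := E i 0 1%N; rewrite /list_code !pickleK in E1.
apply/eqP; rewrite -pair_eqE /pair_eq E1 eqxx andbT; apply/negPn/negP.
(* By symmetry the real entry of [l] is the smaller; a rational in between lies in only one of the
   two cuts. *)
wlog : l m lm E sz E1 / (nth (0, false) l i).1 < (nth (0, false) m i).1.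
  move=> H; rewrite neq_lt => /orP[] lt.
    by apply: (H l m) => //; rewrite lt_eqF.
  by apply: (H m l) => //; rewrite lt_eqF.
move=> /rat_in_itvoo[q]; rewrite in_itv /= => /andP[lq qm] _.
have := E i q 2%N; rewrite /list_code !pickleK qm ltNge.
by rewrite (ltW lq).
Qed.
Definition consistent (s : set R) (l : seq (R * bool)) : bool :=
  all (fun rb => `[< s rb.1 >] == rb.2) l.

(** A list consistent with [s] names a basic neighbourhood of [s] in the product topology on subsets
    of the reals. *)
Definition trace_ind (s : set R) (x : R) : R :=
  `[< exists2 l, x = quaternary (list_code l) & consistent s l >]%:R.

Lemma trace_ind_code s l : trace_ind s (quaternary (list_code l)) = (consistent s l)%:R.
Proof.
rewrite /trace_ind; congr (nat_of_bool _)%:R; apply/asboolP/idP => [[m lm]|]; last by exists l.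
by rewrite (list_code_inj _ _ (quaternary_inj _ _ lm)).
Qed.

Lemma trace_ind_out s x : ~ range quaternary x -> trace_ind s x = 0.
Proof.
move=> nx; rewrite /trace_ind asboolF// => -[l xl _].
by apply: nx; exists (list_code l).
Qed.

Lemma exists_separating_list n (s : 'I_n -> set R) (j : 'I_n) : injective s ->
  exists l, forall i, consistent (s i) l = (i == j).
Proof.
move=> sinj.
have /choice[r rP] : forall i, exists r, i != j -> `[< s i r >] != `[< s j r >].
  move=> i; apply: contrapT => /forallNP nr.
  have ij : i != j by apply/negP => ij; apply: (nr 0); rewrite ij.
  move/negP: (ij); apply; apply/eqP/sinj/funext => r.
  have /not_implyP[_ /negP/negPn/eqP E] := nr r.
  exact: (propext (asbool_eq_equiv E)).
(* Every entry is true of [s j], and the entry at [r i] refutes [s i] for [i] other than [j]. *)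
exists [seq (r i, `[< s j (r i) >]) | i <- enum 'I_n] => i.
rewrite /consistent all_map; apply/allP/eqP => [ij|-> k _ /=]; last exact: eqxx.
apply/eqP/negPn/negP => /rP /negP; apply.
by have := ij i; rewrite mem_enum => /(_ isT).
Qed.

Lemma code_point_D01 (l : seq (R * bool)) : D01 (quaternary (list_code l) : LR R).
Proof. exact: quaternary_itv. Qed.

Definition code_point (l : seq (R * bool)) : I01 R := exist _ _ (code_point_D01 l).

End Code.

(** * Nets indexed by finite lists of null sets *)

Section ConeOfNets.
Context {R : realType} {K : Type} (cover : K -> set (LR R)).
Hypothesis cover_negligible : forall k, Leb.-negligible (cover k).
Hypothesis D01_cover : forall x : LR R, D01 x -> exists k, cover k x.

Definition list_union (l : seq K) : set (LR R) :=
  foldr (fun k U => cover k `|` U) set0 l.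

Definition union_le (l m : seq K) : Prop := list_union l `<=` list_union m.

Lemma list_union_cat l m :
  list_union (l ++ m) = list_union l `|` list_union m.
Proof. by elim: l => [|k l IH] /=; rewrite ?set0U// IH setUA. Qed.

Lemma list_union_negligible l : Leb.-negligible (list_union l).
Proof.
elim: l => [|k l IH] /=; first exact: negligible_set0.
exact: negligibleU.
Qed.

Lemma union_le_directed : directed_set union_le.
Proof.
split => [|l|l m p|l m]; [by apply: (inhabits [::]) | by [] | exact: subset_trans |].
by exists (l ++ m); rewrite /union_le list_union_cat;
  split => x ?; [left | right].
Qed.

Lemma union_le_not_cardinal : ~ is_cardinal_order union_le.
Proof.
have [k _] : exists k, cover k 0 by apply: D01_cover; rewrite /D01 /= lexx ler01.
case=> anti _ _ _.
have E : list_union [:: k; k] = list_union [:: k] by rewrite /= setUA setUid.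
have : [:: k] = [:: k; k] by apply: anti; rewrite /union_le E.
by [].
Qed.

Lemma ext01_val (h : R -> R) (x : LR R) : D01 x ->
  ext01 (fun t : I01 R => h (val t)) x = h x.
Proof. by move=> Dx; rewrite /ext01 insubT. Qed.

(** This form is stable under linear combinations: [sigma] becomes the sum of the coefficients. The
    successor keeps the height nonzero for the empty list. *)
Definition spike (sigma : R) (q : R -> R) (l : seq K) (x : R) : R :=
  sigma * (size l).+1%:R * `[< ~ list_union l x >]%:R + q x.

Lemma spike_in sigma q l x : list_union l x -> spike sigma q l x = q x.
Proof.
by move=> lx; rewrite /spike (_ : `[< _ >] = false) ?mulr0 ?add0r//;
  apply/asboolPn.
Qed.

Lemma spike_out sigma q l x : ~ list_union l x ->
  spike sigma q l x = sigma * (size l).+1%:R + q x.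
Proof. by move=> lx; rewrite /spike asboolT// mulr1. Qed.

Definition spike_net sigma q : net (seq K) R :=
  fun l t => spike sigma q l (val t).

Lemma spike_net_ANM_ND (C : set (LR R)) (sigma : R) (q : R -> R) : sigma != 0 ->
  Leb.-negligible C -> (forall x, ~ C x -> q x = 0) ->
  (ANM union_le `\` ND union_le) (spike_net sigma q).
Proof.
move=> sigma0 C0 qC.
have lC0 l : Leb.-negligible (list_union l `|` C).
  by apply: negligibleU => //; exact: list_union_negligible.
have out l x : D01 x -> ~ (list_union l `|` C) x ->
    ext01 (spike_net sigma q l) x = sigma * (size l).+1%:R.
  move=> Dx /not_orP[lx Cx].
  by rewrite (ext01_val (spike sigma q l))// spike_out// qC// addr0.
split; [split=> [l|] | case=> _ [g [_ gdom _]]].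
- apply: (measurable_fun_ae_cst _ _ _ (lC0 l)) => x Dx; exact: out.
- exists (fun t => q (val t)); split.
  + apply: (measurable_fun_ae_cst _ _ 0 C0) => x Dx Cx.
    by rewrite (ext01_val q)// qC.
  + apply: aeW => x Dx U Ux; have [k kx] := D01_cover _ Dx.
    exists [:: k] => l kl; rewrite (ext01_val (spike sigma q l))//.
    rewrite spike_in; last by apply: kl => /=; left.
    by rewrite -(ext01_val q)//; exact: nbhs_singleton.
  (* With [|sigma|] as epsilon, every deviation set is [D01] up to a null set, so its measure never
     drops below 1. *)
  + have e0 : 0 < `|sigma| by rewrite normr_gt0.
    move=> /(_ _ e0) /(_ [set z : \bar R | (z < 1)%E]) [|l /(_ l)].
      by apply: open_nbhs_nbhs; split; [exact: open_ereal_lt_ereal|exact: lte01].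
    move=> /(_ (@subset_refl _ _)) /=; apply/negP; rewrite -leNgt.
    set S := _ `&` _.
    have : (Leb (D01 : set (LR R)) <= Leb (S `|` (list_union l `|` C)))%E.
      apply: le_Leb => x Dx.
      have [lx|lx] := pselect ((list_union l `|` C) x); [by right|left].
      split => //=; rewrite out// (ext01_val q)// qC; last first.
        by move=> Cx; apply: lx; right.
      by rewrite subr0 normrM ler_peMr// ger0_norm ?ler1n ?ler0n.
    rewrite Leb_D01 => /le_trans; apply.
    by apply: le_trans (LebU_le _ _) _; rewrite (negligible_Leb0 _ (lC0 l)) adde0.
- have [k _] : exists k, cover k 0.
    by apply: D01_cover; rewrite /D01 /= lexx ler01.
  suff : \forall x \ae Leb, ~ D01 (x : LR R).
    by move/negligibleS => /(_ D01)/= D0; apply: (@not_negligible_D01 R);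
      apply: D0 => x Dx; exact.
  (* Repeating one [k] gives countably many indices of unbounded size, so their exceptional null
     sets can be united. *)
  have := ae_foralln (fun n => gdom (nseq n k)).
  have : \forall x \ae Leb, forall n, ~ (list_union (nseq n k) `|` C) x.
    apply: ae_foralln => n; apply: negligibleS (lC0 (nseq n k)).
    by move=> x /= /contrapT.
  apply: filterS2 => x nx gx Dx.
  (* [nseq n k] forces [`|sigma| * n.+1 <= g] almost everywhere, for every [n]. *)
  pose y := `|ext01 g x| / `|sigma|.
  have y0 : 0 <= y by exact: divr_ge0.
  have := archi_boundP y0.
  rewrite ltNge => /negP; apply.
  have := gx (Num.bound y) Dx; rewrite out// size_nseq normrM.
  rewrite ler_pdivlMr ?normr_gt0// mulrC => /le_trans/(_ (ler_norm _)).
  apply: le_trans; apply: ler_wpM2r => //.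
  by rewrite ger0_norm// ler_nat.
Qed.

Definition tagged_net (s : set R) : net (seq K) R := spike_net 1 (trace_ind s).

Lemma tagged_net_inj : injective tagged_net.
Proof.
move=> s s' ss'; apply/funext => r; apply/propext.
(* At an index whose union contains the point the spike vanishes, leaving the value of
   [trace_ind]. *)
have [k kx] := D01_cover _ (code_point_D01 [:: (r, true)]).
have := congr1 (fun F => F [:: k] (code_point [:: (r, true)])) ss'.
rewrite /tagged_net /spike_net !spike_in ?trace_ind_code; try by left.
rewrite /consistent /= !andbT !eqb_id => /eqP; rewrite eqr_nat => bb'.
by apply: asbool_eq_equiv; move: bb'; do 2 case: `[< _ >].
Qed.

Lemma comb_tagged_net n (c : 'I_n -> R) (s : 'I_n -> set R) :
  comb c (fun i => tagged_net (s i)) =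
  spike_net (\sum_i c i) (fun x => \sum_i c i * trace_ind (s i) x).
Proof.
apply/funext => l; apply/funext => t; rewrite /comb /spike_net /spike.
rewrite -mulrA mulr_suml -big_split /=; apply: eq_bigr => i _.
by rewrite /tagged_net /spike_net /spike mul1r mulrDr.
Qed.

Lemma tagged_net_cone n (c : 'I_n -> R) (x : 'I_n -> net (seq K) R) :
  (forall i, range tagged_net (x i)) -> \sum_i c i != 0 ->
  (ANM union_le `\` ND union_le) (comb c x).
Proof.
move=> Bx c0.
have /choice[s sx] : forall i, exists s, tagged_net s = x i.
  by move=> i; have [s _ <-] := Bx i; exists s.
rewrite (_ : x = fun i => tagged_net (s i)); last by apply/funext.
rewrite comb_tagged_net.
apply: (spike_net_ANM_ND _ _ _ c0 negligible_quaternary) => y Cy.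
by rewrite big1// => i _; rewrite trace_ind_out// mulr0.
Qed.

(** At the code point of a list separating [s j], and an index covering that point, only [c j]
    survives. *)
Lemma tagged_net_lin_indep : lin_indep (range tagged_net).
Proof.
move=> n c x xinj Bx cx0 j.
have /choice[s sx] : forall i, exists s, tagged_net s = x i.
  by move=> i; have [s _ <-] := Bx i; exists s.
have xE : x = fun i => tagged_net (s i) by apply/funext.
have sinj : injective s.
  by move=> i i' ii'; apply: xinj; rewrite -!sx ii'.
have [l lP] := exists_separating_list _ s j sinj.
have [k kx] := D01_cover _ (code_point_D01 l).
have := cx0 [:: k] (code_point l).
rewrite xE comb_tagged_net /spike_net spike_in; last by left.
rewrite (bigD1 j)//= trace_ind_code lP eqxx mulr1 big1 ?addr0// => i ij.
by rewrite trace_ind_code lP (negbTE ij) mulr0.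
Qed.

(** The type [set R] represents the cardinal 2^c. One basis serves both signs: a nonempty sum of
    coefficients of one sign is nonzero. *)
Lemma tagged_net_coneable :
  coneable (ANM (R := R) union_le `\` ND union_le) [set: set R].
Proof.
have card : range tagged_net #= [set: set R].
  by apply: inj_card_eq => s s' _ _; exact: tagged_net_inj.
split; exists (range tagged_net); split => //.
- exact: tagged_net_lin_indep.
- move=> n c x Bx c0; apply: tagged_net_cone => //; rewrite gt_eqF//.
  by rewrite big_ord_recl ltr_pwDl// sumr_ge0// => i _; exact: ltW.
- exact: tagged_net_lin_indep.
- move=> n c x Bx c0; apply: tagged_net_cone => //; rewrite lt_eqF//.
  by rewrite big_ord_recl ltr_nwDl// sumr_le0// => i _; exact: ltW.
Qed.

End ConeOfNets.

(** * Covers of least cardinality *)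

Section CoveringNumber.
Context {R : realType}.

Definition null_cover (Fam : set (set (LR R))) : Prop :=
  (forall N, Fam N -> N `<=` D01 /\ Leb.-negligible N) /\
  D01 `<=` \bigcup_(N in Fam) N.

(** This provides one null cover, so that a least one can be chosen. *)
Lemma null_cover_singletons : null_cover [set [set x] | x in D01].
Proof.
split=> [_ [x Dx <-]|x Dx]; last by exists [set x] => //; exists x.
split=> [_ ->//|]; apply: Leb0_negligible.
have -> : [set x] = [set y | (x : R) <= (y : R) <= (x : R)] :> set (LR R).
  apply/seteqP; split=> [y ->|y /=]; first by rewrite /= lexx.
  by move=> yx; apply/eqP; rewrite eq_le andbC.
by rewrite Leb_itvcc// subrr.
Qed.

Lemma exists_least_null_cover : exists Fam, null_cover Fam /\
  forall Fam', null_cover Fam' -> Fam #<= Fam'.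
Proof.
pose I := {Fam | null_cover Fam}.
have [[Fam FamP] least] := exists_least_card I _ (fun i => sval i)
  (exist _ _ null_cover_singletons).
by exists Fam; split => // Fam' Fam'P; exact: (least (exist _ _ Fam'P)).
Qed.

(** A countable null cover would make [D01] null. *)
Lemma null_cover_infinite Fam : null_cover Fam -> infinite_set [set: {N | Fam N}].
Proof.
move=> [FamP Fam_cover] /finite_set_countable /card_le_injP[f [_ finj]].
apply: (@not_negligible_D01 R).
pose G n := [set x | exists2 k : {N | Fam N}, f k = n & sval k x].
apply: (@negligibleS _ _ _ _ (\bigcup_n G n)).
  move=> x /Fam_cover[N FN Nx]; exists (f (exist _ N FN)) => //.
  by exists (exist _ N FN).
apply: negligible_bigcup => n.
have [[k fk]|nk] := pselect (exists k, f k = n); last first.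
  rewrite (_ : G n = set0); first exact: negligible_set0.
  by apply/seteqP; split => // x [k fk _]; apply: nk; exists k.
apply: (@negligibleS _ _ _ _ (sval k)); last first.
  by have [] := FamP _ (svalP k).
by move=> x [k' fk' k'x]; rewrite (finj k k')// fk fk'.
Qed.

(** The list unions are themselves a null cover; conversely lists over the infinite [Fam] are no
    more numerous than [Fam], which is least. *)
Lemma card_is_covN_seq Fam : null_cover Fam ->
  (forall Fam', null_cover Fam' -> Fam #<= Fam') ->
  card_is_covN R (seq {N | Fam N}).
Proof.
move=> FamP least; have [Fam_null Fam_cover] := FamP; split.
  exists (list_union (fun k : {N | Fam N} => sval k)); split=> [l|x].
    split; last first.
      by apply: list_union_negligible => k; have [] := Fam_null _ (svalP k).
    elim: l => [|k l IH] //= x [|/IH//].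
    by have [+ _] := Fam_null _ (svalP k); exact.
  by move=> /Fam_cover[N FN Nx]; exists [:: exist _ N FN] => //; left.
move=> Fam' Fam'_null Fam'_cover.
apply: card_le_trans (card_seq_le _ (null_cover_infinite _ FamP)) _.
apply: card_le_trans (least _ (conj Fam'_null Fam'_cover)).
apply: (card_le_inj _ _ _ _ (fun k => sval k)) => [k _|k k' _ _].
  exact: svalP.
exact: eq_sig_hprop.
Qed.
End CoveringNumber.

Theorem mainTheorem2 (R : realType) :
  exists (A : Type) (le : A -> A -> Prop),
    [/\ directed_set le,
        ~ is_cardinal_order le,
        card_is_covN R A &
        coneable (ANM (R := R) le `\` ND le) [set: set R]].
Proof.
have [Fam [FamP least]] := @exists_least_null_cover R.
have [Fam_null Fam_cover] := FamP.
pose cover (k : {N | Fam N}) : set (LR R) := sval k.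
have cover0 k : Leb.-negligible (cover k) by have [] := Fam_null _ (svalP k).
have D01_cover (x : LR R) : D01 x -> exists k, cover k x.
  by move=> /Fam_cover[N FN Nx]; exists (exist _ N FN).
exists (seq {N | Fam N}), (union_le cover); split.
- exact: union_le_directed.
- exact: union_le_not_cardinal.
- exact: card_is_covN_seq.
- exact: tagged_net_coneable.
Qed.
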